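(* Let $k$ be a positive integer. If $G$ is a graph of order $n\geq 2k+2$ that has no $k$-degenerate cut, then the size (number of edges) of $G$ is at least $$\frac{1}{2}\left(k+\frac{13\sqrt{k}}{190}-\frac{1}{38}\right)n.$$
   Context: All graphs are finite, simple, and undirected. The order of a graph is its number of vertices and its size is its number of edges. For a non-negative integer $k$, a graph $H$ is $k$-degenerate if every non-empty subgraph $H'$ of $H$ has a vertex $u$ of degree $d_{H'}(u)$ at most $k$. A set $S$ of vertices of a graph $G$ is a cut of $G$ if $G-S$ is disconnected (has at least two connected components). A $k$-degenerate cut of $G$ is a cut $S$ of $G$ such that the induced subgraph $G[S]$ is $k$-degenerate. *)

(* Defs.v *)
From mathcomp Require Import all_boot.

Set Implicit Arguments.
Unset Strict Implicit.
Unset Printing Implicit Defensive.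

(* The vertex set is a subset of an ambient finite type T, so that a graph and
   all its subgraphs have the same Rocq type; edges are 2-element vertex sets. *)
Record graph (T : finType) := Graph {
  verts : {set T};
  edges : {set {set T}};
  edgesP : [forall e in edges, (e \subset verts) && (#|e| == 2)]
}.

Section Graphs.
Variable T : finType.
Implicit Types (G H : graph T) (S : {set T}).

Definition graph_order G : nat := #|verts G|.

Definition graph_size G : nat := #|edges G|.

Definition degree G (u : T) : nat := #|[set e in edges G | u \in e]|.

Definition subgraph H G : bool :=
  (verts H \subset verts G) && (edges H \subset edges G).

Lemma induced_edgesP G S :
  [forall e in [set e in edges G | e \subset S],
     (e \subset verts G :&: S) && (#|e| == 2)].
Proof.
apply/forall_inP => e; rewrite inE => /andP[eG eS].
by have /forall_inP/(_ e eG)/andP[eV ->] := edgesP G; rewrite subsetI eV eS.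
Qed.

Definition induced G S : graph T := Graph (induced_edgesP G S).

Definition remove G S : graph T := induced G (verts G :\: S).

Definition adj G : rel T := fun x y => [set x; y] \in edges G.

(* adj G is symmetric and only relates vertices of G (edgesP), so n_comp counts
   the connected components of G. *)
Definition disconnected G : bool := 2 <= n_comp (adj G) (verts G).

Definition degenerate (k : nat) H : Prop :=
  forall H' : graph T, subgraph H' H -> verts H' != set0 ->
  exists2 u, u \in verts H' & degree H' u <= k.

Definition cut G S : Prop := S \subset verts G /\ disconnected (remove G S).

Definition degenerate_cut (k : nat) G S : Prop :=
  cut G S /\ degenerate k (induced G S).

End Graphs.

(* Main.v *)
(** Call a vertex low if its degree is at most k + t, where t = floor(sqrt k / 2),
    and high otherwise.  The neighborhood of a low vertex u separates u from the
    rest, so it contains a set X inducing minimum degree greater than k; as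
    |X| <= k + t, this X is almost a clique.  Suppose that at most k / 2
    neighbors of u are high and take a set A of 2t low vertices of X.  Each
    low vertex of X outside A has at least t neighbors in A, hence at most k
    in N(A), and what else N(A) contains are at most k / 2 high vertices of X and
    2t(t - 1) vertices outside X; so N(A) would be a k-degenerate cut.  Hence more
    than k / 2 neighbors of every low vertex are high, and counting the edges
    between low and high vertices yields the bound. *)
Require Import Defs.
From mathcomp Require Import all_boot all_order all_algebra.
From mathcomp Require Import reals.
From mathcomp Require Import zify lra.
Import Order.TTheory GRing.Theory Num.Theory.
Local Open Scope ring_scope.

Set Implicit Arguments.
Unset Strict Implicit.

Section Neighborhoods.
Local Open Scope nat_scope.
Variable T : finType.
Implicit Types (G H : graph T) (A S X : {set T}) (u v x y : T).

(** * Neighborhoods, degrees and double counting *)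

Definition nbr G u : {set T} := [set v | adj G u v].

(** This set may meet [A], hence the difference [nbrs G A :\: A] in the cuts below. *)
Definition nbrs G A : {set T} := \bigcup_(x in A) nbr G x.

Lemma adj_sym G u v : adj G u v = adj G v u.
Proof. by rewrite /adj setUC. Qed.

Lemma adjP G u v : adj G u v -> [/\ u \in verts G, v \in verts G & u != v].
Proof.
move=> uv; have /forall_inP/(_ _ uv)/andP[/subsetP sub] := edgesP G.
rewrite cards2 eqSS eqb1 => ne; split=> //; apply: sub;
  by rewrite in_set2 eqxx ?orbT.
Qed.

Lemma nbr_sym G u v : (u \in nbr G v) = (v \in nbr G u).
Proof. by rewrite !inE adj_sym. Qed.

Lemma nbr_irr G u : u \notin nbr G u.
Proof. by rewrite inE; apply/negP => /adjP[_ _]; rewrite eqxx. Qed.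

Lemma nbr_verts G u v : v \in nbr G u -> v \in verts G.
Proof. by rewrite inE => /adjP[]. Qed.

Lemma degree_nbr G u : degree G u = #|nbr G u|.
Proof.
rewrite /degree -(card_in_imset (f := fun v => [set u; v])); last first.
  move=> v w; rewrite !inE => /adjP[_ _ uv] /adjP[_ _ uw] E.
  have : v \in [set u; w] by rewrite -E in_set2 eqxx orbT.
  by rewrite in_set2 eq_sym (negPf uv) => /eqP.
congr #|pred_of_set _|; apply/setP => e; rewrite inE.
apply/andP/imsetP => [[eG ue]|[v]]; last first.
  by rewrite inE => uv ->; rewrite in_set2 eqxx.
have /forall_inP/(_ e eG)/andP[_ /cards2P[x [y [_ E]]]] := edgesP G.
move: ue; rewrite E in_set2 => /orP[]/eqP ->.
  by exists y => //; rewrite inE /adj -E.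
by exists x; rewrite ?inE /adj setUC -?E.
Qed.

Lemma sum_degree G : \sum_(v in verts G) degree G v = 2 * graph_size G.
Proof.
have E v : degree G v = \sum_(e in edges G) (v \in e).
  by rewrite /degree -sum1dep_card big_mkcondr.
rewrite (eq_bigr _ (fun v _ => E v)) exchange_big /=.
rewrite mulnC /graph_size -sum_nat_const; apply: eq_bigr => e eG.
have /forall_inP/(_ e eG)/andP[/subsetP sub /eqP <-] := edgesP G.
rewrite -big_mkcondr /= sum1dep_card; apply: eq_card => x; rewrite !inE.
by apply: andb_idl => /sub.
Qed.

Lemma sum_card_nbrI_sym G A B :
  \sum_(u in A) #|nbr G u :&: B| = \sum_(v in B) #|nbr G v :&: A|.
Proof.
have E C u : #|nbr G u :&: C| = \sum_(v in C) adj G u v.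
  by rewrite -big_mkcondr sum1dep_card; apply: eq_card => v; rewrite !inE andbC.
rewrite (eq_bigr _ (fun u _ => E B u)) (eq_bigr _ (fun v _ => E A v)).
rewrite exchange_big; apply: eq_bigr => v _; apply: eq_bigr => u _.
by rewrite adj_sym.
Qed.

(** * Neighborhoods as cuts *)

Lemma disconnected_closed H A x y : x \in A -> y \notin A ->
  x \in verts H -> y \in verts H ->
  (forall v w, v \in A -> adj H v w -> w \in A) -> disconnected H.
Proof.
move=> xA yA xH yH Acl.
have csym : connect_sym (adj H) by apply: sym_connect_sym => v w; rewrite adj_sym.
have clV : closed (adj H) (verts H) by move=> v w /adjP[-> -> _].
have clA : closed (adj H) A.
  move=> v w vw; apply/idP/idP => [vA|wA]; first exact: Acl vA vw.
  by apply: Acl wA _; rewrite adj_sym.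
rewrite /disconnected; apply/card_gt1P.
have rootV z : z \in verts H -> fingraph.root (adj H) z \in verts H.
  by move=> zH; rewrite -(closed_connect clV (connect_root _ z)).
exists (fingraph.root (adj H) x), (fingraph.root (adj H) y).
split; rewrite ?[_ \in predI _ _]inE /= ?roots_root //=; try exact: rootV.
apply: contra yA; rewrite fingraph.root_connect // => /(closed_connect clA) <-.
exact: xA.
Qed.

(** Every edge leaving [A] ends in the removed set, so what remains contains [A] as a union of
    components; [A] itself may be disconnected. *)
Lemma cut_nbrs G A : A \subset verts G -> A != set0 ->
  ~~ (verts G \subset A :|: nbrs G A) -> cut G (nbrs G A :\: A).
Proof.
move=> AV /set0Pn[x xA] /subsetPn[y yV]; rewrite in_setU negb_or => /andP[yA yN].
split.
  apply/subsetP => v /setDP[/bigcupP[z _]]; by move/nbr_verts.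
apply: (@disconnected_closed _ A x y) => //.
- by rewrite !inE xA (subsetP AV).
- by rewrite !inE (negPf yN) yV andbF.
move=> v w vA vw; have [_ + _] := adjP vw.
rewrite !inE => /andP[_ /andP[+ _]]; case: (w \in A) => //= /bigcupP[].
by exists v => //; move: vw; rewrite !inE /adj inE => /andP[].
Qed.

(** Degrees in a subgraph are at most those in the subgraph induced on the same vertices, so only
    vertex sets have to be tested. *)
Lemma degenerate_sets (k : nat) G S :
  (forall X, X \subset S -> X != set0 ->
     exists2 v, v \in X & #|nbr G v :&: X| <= k) ->
  degenerate k (induced G S).
Proof.
move=> dS H /andP[/= /subsetP Hv /subsetP He] H0.
have [|v vH dv] := dS (verts H) _ H0.
  by apply/subsetP => v /Hv /setIP[].
exists v => //; rewrite degree_nbr; apply: leq_trans dv.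
apply/subset_leq_card/subsetP => w; rewrite !inE => vw.
have [_ -> _] := adjP vw; move: (He _ vw).
by rewrite inE andbT => /andP[].
Qed.

Lemma nbrs_dense_subset (k : nat) G A :
  ~ (exists S, degenerate_cut k G S) ->
  A \subset verts G -> A != set0 -> ~~ (verts G \subset A :|: nbrs G A) ->
  exists X, [/\ X \subset nbrs G A :\: A, X != set0 &
    forall v, v \in X -> k < #|nbr G v :&: X|].
Proof.
move=> hG AV A0 NA.
have [/existsP[X /and3P[XS X0 /forall_inP dX]]|no] := boolP
  [exists X : {set T}, [&& X \subset nbrs G A :\: A, X != set0 &
    [forall v in X, k < #|nbr G v :&: X|]]]; first by exists X.
case: hG; exists (nbrs G A :\: A); split; first exact: cut_nbrs.
apply: degenerate_sets => X XS X0; move: no.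
rewrite negb_exists => /forallP/(_ X); rewrite XS X0 /= negb_forall_in.
by case/exists_inP => v vX; rewrite -leqNgt; exists v.
Qed.

(** * Sets inducing minimum degree above [k], and low vertices *)

Lemma dense_card (k : nat) G X : X != set0 ->
  (forall v, v \in X -> k < #|nbr G v :&: X|) -> k.+2 <= #|X|.
Proof.
case/set0Pn => v vX /(_ v vX) lt; apply: leq_ltn_trans lt _.
apply/proper_card/properP; split; first exact: subsetIr.
by exists v; rewrite // in_setI (negPf (nbr_irr _ _)).
Qed.

(** The argument with [A] uses only that [X] is dense and small; [low_vertex] applies it to a set
    [X] inside the neighborhood of a low vertex. *)
Lemma dense_set_high (k t : nat) G X :
  ~ (exists S, degenerate_cut k G S) ->
  4 * t ^ 2 <= k -> 2 * k + 2 <= #|verts G| ->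
  X \subset verts G -> X != set0 -> #|X| <= k + t ->
  (forall v, v \in X -> k < #|nbr G v :&: X|) ->
  k < 2 * #|X :&: [set v in verts G | k + t < degree G v]|.
Proof.
move=> hG tk kn XV X0 Xle dX; set B := [set v in _ | _].
rewrite ltnNge; apply/negP => hle.
have Xge := dense_card X0 dX.
have XB : #|X :&: B| + #|X :\: B| = #|X| by rewrite cardsID.
(* At least [k + 2] vertices lie in [X], at most [k / 2] of them in [B], and
   [2 * t <= 2 * t ^ 2 <= k / 2]. *)
have : 2 * t <= #|X :\: B| by nia.
case/card_geqP => s [us ss sub]; pose A := [set x in s].
have cA : #|A| = 2 * t by rewrite cardsE (card_uniqP us).
have AX x : x \in A -> x \in X /\ degree G x <= k + t.
  rewrite inE => /sub; rewrite !inE => /andP[+ xX].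
  by rewrite (subsetP XV) //= -leqNgt.
have AsX : A \subset X by apply/subsetP => x /AX[].
(* Each [x] in [A] has degree at most [k + t] and more than [k] neighbors in [X], hence at most
   [t - 1] outside. *)
have cout : #|nbrs G A :\: X| <= 2 * t * (t - 1).
  rewrite -cA -sum_nat_const.
  have -> : nbrs G A :\: X = \bigcup_(x in A) (nbr G x :\: X).
    apply/setP => y; rewrite in_setD; apply/andP/bigcupP.
      by case=> yX /bigcupP[x xA yx]; exists x; rewrite // in_setD yX.
    case=> x xA /setDP[yx ->]; split=> //; by apply/bigcupP; exists x.
  apply: leq_trans (_ : \sum_(x in A) #|nbr G x :\: X| <= _).
    elim/big_rec2: _ => [|x a Z _ le]; first by rewrite cards0.
    by apply: leq_trans (leq_card_setU _ _) _; rewrite leq_add2l.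
  apply: leq_sum => x /AX[/dX dx]; rewrite degree_nbr.
  have := cardsID X (nbr G x); lia.
have A0 : A != set0 by rewrite -card_gt0 cA; lia.
have [|Y [YS Y0 dY]] := nbrs_dense_subset hG (subset_trans AsX XV) A0.
  (* [A] and its neighbors number at most [k + t + 2 * t * (t - 1)], which is below [2 * k + 2]. *)
  apply/negP => /subset_leq_card.
  have : #|A :|: nbrs G A| <= #|X :|: (nbrs G A :\: X)|.
    apply/subset_leq_card/subsetP => y; rewrite !in_setU in_setD.
    by case/orP => [/(subsetP AsX) ->//|->]; rewrite andbT orbN.
  have [+ _] := leq_card_setU X (nbrs G A :\: X); nia.
(* At most [t - 1] vertices of [X] are not adjacent to [v], so [A] contains at least [t] neighbors
   of [v]. If [v] were low, at most [k] neighbors would be left for [Y], which avoids [A]. *)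
have YXB v : v \in Y -> v \in X -> v \in B.
  move=> vY vX; have /setDP[_ vA] := subsetP YS v vY.
  rewrite inE (subsetP XV) //= ltnNge; apply/negP; rewrite degree_nbr => dv.
  have := dY v vY.
  have := cardsID A (nbr G v); have := cardsID (nbr G v) A; rewrite cA [A :&: _]setIC.
  have : #|nbr G v :&: Y| <= #|nbr G v :\: A|.
    apply/subset_leq_card/subsetP => w /setIP[vw /(subsetP YS)/setDP[_ wA]].
    by rewrite in_setD wA.
  have : #|A :\: nbr G v| < #|X :\: nbr G v|.
    apply/proper_card/properP; split; first exact: setSD.
    by exists v; rewrite !in_setD ?nbr_irr ?vX // (negPf vA) andbF.
  have := cardsID (nbr G v) X; have := dX v vX; rewrite [X :&: _]setIC; lia.
(* Density forces [k + 2] vertices in [Y], but there are at most [k / 2 + 2 * t * (t - 1) <= k]. *)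
have := dense_card Y0 dY.
have : #|Y| <= #|(X :&: B) :|: (nbrs G A :\: X)|.
  apply/subset_leq_card/subsetP => y yY.
  rewrite in_setU in_setI in_setD; have /setDP[-> _] := subsetP YS y yY.
  by rewrite andbT; case: (boolP (y \in X)) => //= /(YXB y yY) ->.
have [+ _] := leq_card_setU (X :&: B) (nbrs G A :\: X); nia.
Qed.

Lemma low_vertex (k t : nat) G u :
  ~ (exists S, degenerate_cut k G S) ->
  4 * t ^ 2 <= k -> 2 * k + 2 <= #|verts G| ->
  u \in verts G -> degree G u <= k + t ->
  k < degree G u /\
  k < 2 * #|nbr G u :&: [set v in verts G | k + t < degree G v]|.
Proof.
move=> hG tk kn uV; rewrite degree_nbr => du.
have N1 : nbrs G [set u] = nbr G u by rewrite /nbrs big_set1.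
have [|||X [XS X0 dX]] := @nbrs_dense_subset k G [set u] hG.
- by rewrite sub1set.
- by apply/set0Pn; exists u; rewrite set11.
(* The closed neighborhood of [u] has at most [k + t + 1 < 2 * k + 2] vertices. *)
- apply/negP => /subset_leq_card; rewrite N1 => le.
  by have [+ _] := leq_card_setU [set u] (nbr G u); rewrite cards1; nia.
have Xn : X \subset nbr G u.
  by rewrite -N1; apply: subset_trans XS (subsetDl _ _).
have XV : X \subset verts G by apply/subsetP => v /(subsetP Xn)/nbr_verts.
have cX := subset_leq_card Xn; have := dense_card X0 dX; split; first by lia.
have := dense_set_high hG tk kn XV X0 (leq_trans cX du) dX.
have := subset_leq_card (setSI [set v in verts G | k + t < degree G v] Xn); lia.
Qed.

(** * Counting edges between low and high vertices *)

Lemma degree_sums (k t : nat) G :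
  ~ (exists S, degenerate_cut k G S) ->
  4 * t ^ 2 <= k -> 2 * k + 2 <= #|verts G| ->
  exists D p q, [/\ #|verts G| = p + q, D + k * q <= 2 * graph_size G,
    (k + t + 1) * p <= D & k * q <= 2 * D].
Proof.
move=> hG tk kn; pose B := [set v in verts G | k + t < degree G v].
have BV : B \subset verts G by apply/subsetP => v /setIdP[].
have VB : verts G :&: B = B by apply/setIidPr.
(* [D] is the degree sum of the high vertices, [p] their number, and [q] the number of low
   vertices. *)
exists (\sum_(v in B) degree G v), #|B|, #|verts G :\: B|.
have low u : u \in verts G :\: B -> k < degree G u /\ k < 2 * #|nbr G u :&: B|.
  case/setDP=> uV; rewrite inE uV /= -leqNgt => du.
  exact: low_vertex.
split.
- by rewrite -{1}VB cardsID.
- rewrite -sum_degree [leqRHS](big_setID B) /= VB leq_add2l mulnC -sum_nat_const.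
  by apply: leq_sum => u /low[/ltnW].
- rewrite mulnC -sum_nat_const; apply: leq_sum => v /setIdP[_].
  by rewrite addn1.
rewrite mulnC -sum_nat_const.
apply: leq_trans (_ : 2 * \sum_(u in verts G :\: B) #|nbr G u :&: B| <= _).
  by rewrite big_distrr; apply: leq_sum => u /low[_ /ltnW].
rewrite leq_mul2l sum_card_nbrI_sym; apply: leq_sum => v _.
by rewrite degree_nbr; apply/subset_leq_card/subsetIl.
Qed.

(** * The choice of [t] and the numerical bound *)

Lemma half_sqrt_floor (k : nat) : exists t, 4 * t ^ 2 <= k < 4 * t.+1 ^ 2.
Proof.
have ex0 : exists t, 4 * t ^ 2 <= k by exists 0.
have bd t : 4 * t ^ 2 <= k -> t <= k by nia.
case: (ex_maxnP ex0 bd) => t tk tmax; exists t; rewrite tk ltnNge.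
by apply/negP => /tmax; rewrite ltnn.
Qed.

End Neighborhoods.

Lemma edge_bound (R : realFieldType) (k t r D p q m : R) :
  1 <= k -> 0 <= t -> 4 * t <= k -> 0 <= r -> r <= 2 * (t + 1) ->
  0 <= D -> 0 <= p -> 0 <= q ->
  D + k * q <= 2 * m -> (k + t + 1) * p <= D -> k * q <= 2 * D ->
  1 / 2 * (k + 13 * r / 190 - 1 / 38) * (p + q) <= m.
Proof.
move=> k0 t0 t4k r0 rt D0 p0 q0 mD Dp Dq.
pose s := 13 * r / 190.
have s0 : 0 <= s by rewrite /s; lra.
(* Adding [k * q] to both sides gives [(k + s) * (p + q) <= 2 * m]. *)
suff key : (k + s) * p + s * q <= D by rewrite /s in key *; nra.
have M0 : 0 < k + t + 1 by lra.
have kM : 0 < k * (k + t + 1) by apply: mulr_gt0; lra.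
(* Bounding [p] by [D / (k + t + 1)] and [q] by [2 * D / k] reduces [key] to this inequality, after
   clearing denominators. It holds since [3 * k + 2 * t + 2 <= 11 / 2 * k] and
   [26 / 190 * 11 / 2 < 1]. *)
have c1 : s * (3 * k + 2 * t + 2) <= k * (t + 1).
  have : s <= 26 / 190 * (t + 1) by rewrite /s; lra.
  nra.
rewrite -(ler_pM2l kM).
have e1 : k * (k + s) * ((k + t + 1) * p) <= k * (k + s) * D.
  by apply: ler_wpM2l => //; apply: mulr_ge0; lra.
have e2 : s * (k + t + 1) * (k * q) <= s * (k + t + 1) * (2 * D).
  by apply: ler_wpM2l => //; apply: mulr_ge0; lra.
have e3 := ler_wpM2r D0 c1.
nra.
Qed.

Theorem theorem1 (R : realType) (k : nat) (hk : (0 < k)%N)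
    (T : finType) (G : graph T) (n : nat) (hn : graph_order G = n)
    (hnk : (2 * k + 2 <= n)%N)
    (hG : ~ exists S : {set T}, degenerate_cut k G S) :
  1 / 2 * (k%:R + 13 * Num.sqrt k%:R / 190 - 1 / 38) * n%:R
    <= (graph_size G)%:R :> R.
Proof.
have [t /andP[tk kt]] := half_sqrt_floor k.
move: (hnk); rewrite -hn => /(degree_sums hG tk)[D [p [q [Vpq mD Dp Dq]]]].
have t4k : (4 * t <= k)%N by nia.
have rt : Num.sqrt k%:R <= 2 * (t%:R + 1) :> R.
  have -> : 2 * (t%:R + 1) = Num.sqrt ((2 * (t%:R + 1)) ^+ 2) :> R.
    by rewrite sqrtr_sqr ger0_norm // mulr_ge0 ?addr_ge0.
  apply: ler_wsqrtr; have := ltnW kt.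
  by rewrite -(ler_nat R) natrM natrX -natr1; lra.
have r0 : 0 <= Num.sqrt k%:R :> R by exact: sqrtr_ge0.
rewrite /graph_order Vpq natrD.
move: mD Dp Dq t4k hk; rewrite -!(ler_nat R) !(natrD, natrM) => mD Dp Dq t4k k1.
exact: (edge_bound k1 _ t4k r0 rt _ _ _ mD Dp Dq).
Qed.
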